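(* Let $k$ be a field of characteristic zero, let $(S,\cdot)$ be a monoid, let $A$ be an $S$-graded $k$-algebra, $A=\bigoplus_{s\in S}A_s$, and let $H=kS$. Then $A$ is a left $kG(H^\circ)$-module algebra, where the action is the restriction to $kG(H^\circ)\subseteq H^*$ of the map $\gamma:H^*\otimes A\to A$, $\gamma(f\otimes a)=\sum_{s\in S} f(s)\,a_s$ for $f\in H^*$ and $a=\sum_{s}a_s$ with $a_s\in A_s$.
   Context: Algebras are unital associative $k$-algebras. An algebra $A$ is $S$-graded if $A=\bigoplus_{s\in S}A_s$ with $A_s$ subspaces such that $A_sA_t\subseteq A_{st}$ for all $s,t\in S$. $kS$ is the monoid algebra, a bialgebra with $\Delta(s)=s\otimes s$, $\epsilon(s)=1$ for $s\in S$. For an algebra $H$, $H^*=\mathrm{Hom}_k(H,k)$ is the linear dual and the finite dual is $H^\circ=\{f\in H^*\mid f(I)=0 \text{ for some ideal } I\subseteq H \text{ with } \dim(H/I)<\infty\}$. If $H$ is a bialgebra then $H^\circ$ is a bialgebra: for $H=kS$ its product is pointwise on $S$, its coproduct is determined by $\Delta'(f)(x\otimes y)=f(xy)$, and its counit is $\epsilon'(f)=f(1)$. For a coalgebra $(C,\Delta,\epsilon)$, $G(C)=\{c\in C\mid \Delta(c)=c\otimes c,\ \epsilon(c)=1\}$ is the set of group-like elements. $kG(H^\circ)$ denotes the subspace of $H^\circ$ spanned by $G(H^\circ)$, with the bialgebra structure inherited from $H^\circ$. For a bialgebra $B$, a left $B$-module algebra is an algebra $A$ that is a left $B$-module with $b\cdot(aa')=\sum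 (b_{1}\cdot a)(b_{2}\cdot a')$ (where $\Delta(b)=\sum b_1\otimes b_2$) and $b\cdot 1_A=\epsilon(b)1_A$ for all $b\in B$, $a,a'\in A$.
   Formalization: The formal theorem adds the hypothesis that the unit 1_A lies in A_1, which the stated definition of an S-graded algebra does not imply for a general monoid; without it the claim fails (S={1,e} with e²=e, A=k=A_e, f(1)=1, f(e)=0). *)

(* Defs.v *)
From HB Require Import structures.
From mathcomp Require Import all_boot all_order all_algebra finmap.
From mathcomp Require Import boolp classical_sets functions.
From mathcomp Require Import monalg.

Set Implicit Arguments.
Unset Strict Implicit.
Unset Printing Implicit Defensive.

Import GRing.Theory.

Local Open Scope ring_scope.

Section Span.
Variables (k : fieldType) (V : lmodType k).

Definition subspace (P : set V) : Prop :=
  P 0 /\ forall (c : k) x y, P x -> P y -> P (c *: x + y).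

Inductive span (P : set V) : set V :=
| span0 : span P 0
| spanS c x y : P x -> span P y -> span P (c *: x + y).

Lemma span_subspace P : subspace (span P).
Proof.
split=> [|c x y Px Py]; first exact: span0.
elim: Px => [|d u v Pu _ ih]; first by rewrite scaler0 add0r.
by rewrite scalerDr scalerA -addrA; apply: spanS.
Qed.

Lemma span_in (P : set V) x : P x -> span P x.
Proof. by move=> Px; rewrite -[x]scale1r -[_ *: x]addr0; apply: spanS => //; apply: span0. Qed.

Definition memp (P : set V) : {pred V} := [pred x | `[< P x >]].

Lemma subspace_closed P : subspace P -> GRing.submod_closed (memp P).
Proof.
case=> P0 PD; split=> [|c x y]; first exact/asboolP.
by move=> /asboolP Px /asboolP Py; apply/asboolP; apply: PD.
Qed.

End Span.

Section Tensor.
Variables (k : fieldType) (V W : lmodType k).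

Local Notation F := {malg k[(V * W)%type]}.

Inductive tens_rel : set F :=
| tens_relDl v v' w :
    tens_rel (<< (v + v', w) >> - << (v, w) >> - << (v', w) >>)
| tens_relDr v w w' :
    tens_rel (<< (v, w + w') >> - << (v, w) >> - << (v, w') >>)
| tens_relZl c v w : tens_rel (<< (c *: v, w) >> - c *: << (v, w) >>)
| tens_relZr c v w : tens_rel (<< (v, c *: w) >> - c *: << (v, w) >>).

Definition tens_ideal := memp (span tens_rel).

HB.instance Definition _ := GRing.isSubmodClosed.Build k F tens_ideal
  (subspace_closed (span_subspace tens_rel)).

Definition tens : Type := Quotient.quot tens_ideal.
HB.instance Definition _ := GRing.Zmodule.on tens.

Definition tproj (x : F) : tens := (\pi_(Quotient.quot tens_ideal) x)%qT.
Definition trepr (t : tens) : F := repr (t : Quotient.quot tens_ideal).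

Lemma treprK : cancel trepr tproj. Proof. exact: reprK. Qed.

Lemma tprojP x y : tproj x = tproj y <-> span tens_rel (x - y).
Proof.
split=> [/eqmodP|h]; first by rewrite /= Quotient.equivE => /asboolP.
by apply/eqmodP; rewrite /= Quotient.equivE; apply/asboolP.
Qed.

Lemma tprojD x y : tproj (x + y) = tproj x + tproj y.
Proof. exact: Quotient.pi_add. Qed.

Definition tscale (c : k) (t : tens) : tens := tproj (c *: trepr t).

Lemma tprojZ c x : tproj (c *: x) = tscale c (tproj x).
Proof.
apply/tprojP; rewrite -scalerBr.
have /tprojP h : tproj x = tproj (trepr (tproj x)) by rewrite treprK.
rewrite -[_ *: _]addr0; apply: (span_subspace _).2 => //; exact: span0.
Qed.

Lemma tscaleA a b t : tscale a (tscale b t) = tscale (a * b) t.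
Proof. by rewrite -[t]treprK -!tprojZ scalerA. Qed.
Lemma tscale1 : left_id 1 tscale.
Proof. by move=> t; rewrite -[t]treprK -!tprojZ scale1r. Qed.
Lemma tscaleDr : right_distributive tscale +%R.
Proof.
by move=> c t u; rewrite -[t]treprK -[u]treprK -!(tprojZ, tprojD) scalerDr.
Qed.
Lemma tscaleDl t : {morph tscale^~ t : a b / a + b}.
Proof. by move=> a b; rewrite -[t]treprK -!(tprojZ, tprojD) scalerDl. Qed.

HB.instance Definition _ :=
  GRing.Zmodule_isLmodule.Build k tens tscaleA tscale1 tscaleDr tscaleDl.

Lemma tproj_is_linear : linear tproj.
Proof. by move=> c x y; rewrite tprojD tprojZ. Qed.
HB.instance Definition _ :=
  GRing.isLinear.Build k F tens _ tproj tproj_is_linear.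

Definition tpure (v : V) (w : W) : tens := tproj << (v, w) >>.

End Tensor.

Notation "v \ox w" := (tpure v w) (at level 40, left associativity) : ring_scope.

Section LinearExtension.
Variables (k : fieldType) (X : choiceType) (U : lmodType k) (phi : X -> U).

Definition lext (g : {malg k[X]}) : U := \sum_(x <- msupp g) g@_x *: phi x.

Lemma lextEw (d : {fset X}) g : (msupp g `<=` d)%fset ->
  lext g = \sum_(x <- d) g@_x *: phi x.
Proof.
move=> le; rewrite [LHS](big_fset_incl _ le) //= => x _ /mcoeff_outdom ->.
by rewrite scale0r.
Qed.

Lemma lext_is_linear : linear lext.
Proof.
move=> c g h; set d := (msupp g `|` msupp h)%fset.
have gd : (msupp g `<=` d)%fset by exact: fsubsetUl.
have hd : (msupp h `<=` d)%fset by exact: fsubsetUr.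
rewrite (lextEw gd) (lextEw hd) (@lextEw d); last first.
  apply: fsubset_trans (msuppD_le _ _) _.
  by rewrite fsubUset hd andbT (fsubset_trans (msuppZ_le _ _)).
rewrite scaler_sumr -big_split /=; apply: eq_bigr => x _.
by rewrite mcoeffD mcoeffZ scalerDl scalerA.
Qed.
HB.instance Definition _ :=
  GRing.isLinear.Build k {malg k[X]} U _ lext lext_is_linear.

Lemma lextU x : lext << x >> = phi x.
Proof. by rewrite (lextEw msuppU_le) big_seq_fset1 mcoeffUU scale1r. Qed.

End LinearExtension.

Definition bilin (k : fieldType) (V W U : lmodType k) (b : V -> W -> U) : Prop :=
  (forall w, linear (b^~ w)) /\ (forall v, linear (b v)).

Section TensorLift.
Variables (k : fieldType) (V W U : lmodType k).

(* Independent of the representative [trepr t] only when [b] is bilinear. *)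
Definition tlift (b : V -> W -> U) (t : tens V W) : U :=
  lext (fun p => b p.1 p.2) (trepr t).

Variables (b : V -> W -> U) (hb : bilin b).

Lemma tlift_tproj x : tlift b (tproj x) = lext (fun p => b p.1 p.2) x.
Proof.
have /tprojP : tproj (trepr (tproj x)) = tproj x by rewrite treprK.
rewrite /tlift; move: (trepr _) => y h; apply/eqP; rewrite -subr_eq0.
rewrite -linearB /=; apply/eqP; elim: h => [|c u v ru _ ih].
  by rewrite linear0.
rewrite linearP /= ih addr0; case: ru => [v1 v2 w|v1 w1 w2|d v1 w|d v1 w];
  rewrite ?linearB ?linearZ /= ?lextU /=; have [hl hr] := hb.
- by have := hl w 1 v1 v2; rewrite !scale1r => /= ->; rewrite -!scalerDr addrAC addrK subrr scaler0.
- by have := hr v1 1 w1 w2; rewrite !scale1r => /= ->; rewrite -!scalerDr addrAC addrK subrr scaler0.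
- have h0 : b 0 w = 0 by have := hl w (-1) 0 0; rewrite scaler0 addr0 scaleN1r addNr.
  by have := hl w d v1 0; rewrite h0 !addr0 => /= ->; rewrite -scalerDr scalerN subrr scaler0.
- have h0 : b v1 0 = 0 by have := hr v1 (-1) 0 0; rewrite scaler0 addr0 scaleN1r addNr.
  by have := hr v1 d w 0; rewrite h0 !addr0 => /= ->; rewrite -scalerDr scalerN subrr scaler0.
Qed.

Lemma tlift_pure v w : tlift b (v \ox w) = b v w.
Proof. by rewrite tlift_tproj lextU. Qed.

Lemma tlift_linear : linear (tlift b).
Proof.
by move=> c t u; rewrite -[t]treprK -[u]treprK -linearP !tlift_tproj linearP.
Qed.

Lemma tlift_sum (I : Type) (r : seq I) (P : pred I) (t : I -> tens V W) :
  tlift b (\sum_(i <- r | P i) t i) = \sum_(i <- r | P i) tlift b (t i).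
Proof.
have h0 : tlift b 0 = 0.
  by have := tlift_linear (-1) 0 0; rewrite scaler0 addr0 scaleN1r addNr.
apply: big_morph => // x y; have := tlift_linear 1 x y; by rewrite !scale1r.
Qed.

End TensorLift.

Section TensorTheory.
Variables (k : fieldType) (V W : lmodType k).
Implicit Types (v : V) (w : W) (t : tens V W).

Lemma tpure_bilin : bilin (@tpure k V W).
Proof.
split=> [w c v v'|v c w w']; rewrite /tpure -linearP /=; apply/tprojP.
  rewrite -[X in span _ X]scale1r opprD addrA.
  have -> : 1 *: (<<(c *: v + v', w)>> - c *: <<(v, w)>> - <<(v', w)>>) =
    1 *: (<<(c *: v + v', w)>> - <<(c *: v, w)>> - <<(v', w)>>) +
    (1 *: (<<(c *: v, w)>> - c *: <<(v, w)>>) + 0) :> {malg k[(V * W)%type]}.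
    by rewrite !scale1r addr0 [RHS]addrC [RHS]addrA [X in _ = X - _]addrC [X in _ = X - _]addrA subrK.
  apply: spanS; first exact: tens_relDl.
  by apply: spanS; [exact: tens_relZl | exact: span0].
rewrite -[X in span _ X]scale1r opprD addrA.
have -> : 1 *: (<<(v, c *: w + w')>> - c *: <<(v, w)>> - <<(v, w')>>) =
  1 *: (<<(v, c *: w + w')>> - <<(v, c *: w)>> - <<(v, w')>>) +
  (1 *: (<<(v, c *: w)>> - c *: <<(v, w)>>) + 0) :> {malg k[(V * W)%type]}.
  by rewrite !scale1r addr0 [RHS]addrC [RHS]addrA [X in _ = X - _]addrC [X in _ = X - _]addrA subrK.
apply: spanS; first exact: tens_relDr.
by apply: spanS; [exact: tens_relZr | exact: span0].
Qed.

Lemma tpure_linl w : linear (fun v => v \ox w).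
Proof. exact: tpure_bilin.1. Qed.
Lemma tpure_linr v : linear (fun w => v \ox w).
Proof. exact: tpure_bilin.2. Qed.

Lemma tpureDl v v' w : (v + v') \ox w = v \ox w + v' \ox w.
Proof. by have := tpure_linl w 1 v v'; rewrite !scale1r. Qed.
Lemma tpureDr v w w' : v \ox (w + w') = v \ox w + v \ox w'.
Proof. by have := tpure_linr v 1 w w'; rewrite !scale1r. Qed.
Lemma tpure0l w : (0 : V) \ox w = 0.
Proof. by apply: (addrI (0 \ox w)); rewrite -tpureDl !addr0. Qed.
Lemma tpure0r v : v \ox (0 : W) = 0.
Proof. by apply: (addrI (v \ox 0)); rewrite -tpureDr !addr0. Qed.
Lemma tpureZl c v w : (c *: v) \ox w = c *: (v \ox w).
Proof. by have := tpure_linl w c v 0; rewrite addr0 tpure0l addr0. Qed.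
Lemma tpureZr c v w : v \ox (c *: w) = c *: (v \ox w).
Proof. by have := tpure_linr v c w 0; rewrite addr0 tpure0r addr0. Qed.
Lemma tpureNl v w : (- v) \ox w = - (v \ox w).
Proof. by rewrite -scaleN1r tpureZl scaleN1r. Qed.
Lemma tpureNr v w : v \ox (- w) = - (v \ox w).
Proof. by rewrite -scaleN1r tpureZr scaleN1r. Qed.
Lemma tpure_suml (I : Type) (r : seq I) (f : I -> V) w :
  (\sum_(i <- r) f i) \ox w = \sum_(i <- r) f i \ox w.
Proof.
by apply: (big_morph (fun v => v \ox w)) => [x y|]; rewrite ?tpureDl ?tpure0l.
Qed.

Lemma tensE t : exists s : seq (V * W), t = \sum_(p <- s) p.1 \ox p.2.
Proof.
exists [seq ((trepr t)@_x *: x.1, x.2) | x <- msupp (trepr t)].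
rewrite big_map /= -{1}[t]treprK {1}[trepr t]monalgE linear_sum /=.
apply: eq_bigr => -[v w] _ /=; rewrite tpureZl /tpure -linearZ /=.
by congr tproj; apply/malgP => x; rewrite mcoeffZ !mcoeffU mulr_natr.
Qed.

Lemma tlift_eq (U : lmodType k) (f g : tens V W -> U) :
  linear f -> linear g -> (forall v w, f (v \ox w) = g (v \ox w)) -> f =1 g.
Proof.
move=> hf hg h t; have [s ->] := tensE t.
pose f' := GRing.isLinear.Build k (tens V W) U _ f hf.
have f0 : f 0 = 0 by have := hf (-1) 0 0; rewrite scaler0 addr0 scaleN1r addNr.
have g0 : g 0 = 0 by have := hg (-1) 0 0; rewrite scaler0 addr0 scaleN1r addNr.
elim: s => [|p s ih]; first by rewrite big_nil f0 g0.
rewrite big_cons -[_ \ox _]scale1r hf hg h ih //.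
Qed.

(* Functionals separating [V] and [W] give functionals separating [tens V W]. *)
Section Separation.
Variables (X Y : Type) (eV : V -> X -> k) (eW : W -> Y -> k).
Hypothesis eV_lin : forall x, linear (fun v => eV v x : k^o).
Hypothesis eW_lin : forall y, linear (fun w => eW w y : k^o).
Hypothesis eV_sep : forall v, (forall x, eV v x = 0) -> v = 0.
Hypothesis eW_sep : forall w, (forall y, eW w y = 0) -> w = 0.

Definition tev (t : tens V W) (p : X * Y) : k :=
  tlift (fun v w => eV v p.1 * eW w p.2 : k^o) t.

Lemma tev_bilin p : bilin (fun v w => eV v p.1 * eW w p.2 : k^o).
Proof.
split=> [w c v v'|v c w w'] /=.
  by rewrite eV_lin mulrDl /GRing.scale /= mulrA.
by rewrite eW_lin mulrDr /GRing.scale /= mulrCA.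
Qed.

Lemma tev_linear p : linear (fun t => tev t p : k^o).
Proof. exact: tlift_linear (tev_bilin p). Qed.

Lemma tev_sum (s : seq (V * W)) p :
  tev (\sum_(q <- s) q.1 \ox q.2) p = \sum_(q <- s) eV q.1 p.1 * eW q.2 p.2.
Proof.
rewrite /tev (tlift_sum (tev_bilin p)); apply: eq_bigr => q _.
by rewrite (tlift_pure (tev_bilin p)).
Qed.

Lemma tev_sep t : (forall p, tev t p = 0) -> t = 0.
Proof.
have [s ->] := tensE t => h.
have {h} : forall x y, \sum_(q <- s) eV q.1 x * eW q.2 y = 0.
  by move=> x y; have := h (x, y); rewrite tev_sum.
have [n] := ubnP (size s); elim: n s => // n IHn [|[v w] s] /= sz h.
  by rewrite big_nil.
have eVD x a b : eV (a + b) x = eV a x + eV b x.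
  by have := eV_lin x 1 a b; rewrite scale1r => ->; rewrite /GRing.scale /= mul1r.
have eV0 x : eV 0 x = 0 by apply: (addrI (eV 0 x)); rewrite -eVD !addr0.
have eVZ x c a : eV (c *: a) x = c * eV a x.
  by have := eV_lin x c a 0; rewrite !addr0 eV0 addr0 => ->.
have eVN x a : eV (- a) x = - eV a x by rewrite -scaleN1r eVZ mulN1r.
have eWD y a b : eW (a + b) y = eW a y + eW b y.
  by have := eW_lin y 1 a b; rewrite scale1r => ->; rewrite /GRing.scale /= mul1r.
have eW0 y : eW 0 y = 0 by apply: (addrI (eW 0 y)); rewrite -eWD !addr0.
have eWZ y c a : eW (c *: a) y = c * eW a y.
  by have := eW_lin y c a 0; rewrite !addr0 eW0 addr0 => ->.
have [[y0 /eqP wy0]|/forallNP w0] := pselect (exists y, eW w y <> 0); last first.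
  have -> : w = 0 by apply: eW_sep => y; apply: contrapT; exact: w0.
  rewrite big_cons /= tpure0r add0r; apply: IHn => // x y.
  have := h x y; rewrite big_cons /=.
  by rewrite (_ : eW w y = 0) ?mulr0 ?add0r //; apply: contrapT; exact: w0.
pose a (q : V * W) := eW q.2 y0 / eW w y0.
have vE : v = - \sum_(q <- s) a q *: q.1.
  apply/eqP; rewrite -addr_eq0; apply/eqP/eV_sep => x.
  rewrite eVD (big_morph (fun u => eV u x) (eVD x) (eV0 x)).
  have := h x y0; rewrite big_cons /= => /(congr1 (fun z => z / eW w y0)).
  rewrite mul0r mulrDl mulfK // mulr_suml => e; apply: etrans e; apply: (congr1 (+%R (eV v x))).
  by apply: eq_bigr => q _; rewrite eVZ /a mulrAC [eW _ _ * _]mulrC.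
have -> : \sum_(q <- (v, w) :: s) q.1 \ox q.2 =
    \sum_(q <- [seq (q.1, q.2 - a q *: w) | q <- s]) q.1 \ox q.2.
  rewrite big_cons big_map /= {1}vE tpureNl tpure_suml addrC -sumrB.
  by apply: eq_bigr => q _; rewrite tpureDr tpureNr tpureZr tpureZl.
apply: IHn => [|x y]; first by rewrite size_map.
apply: etrans (h x y); rewrite big_cons big_map /= {1}vE eVN.
rewrite (big_morph (fun u => eV u x) (eVD x) (eV0 x)) mulNr mulr_suml addrC.
rewrite -sumrB; apply: eq_bigr => q _.
rewrite eWD -scaleN1r !eWZ eVZ mulrDr; congr (_ + _).
by rewrite mulN1r mulrN mulrCA mulrA.
Qed.

End Separation.
End TensorTheory.

Section LinearHelpers.
Variables (k : fieldType) (V W : lmodType k).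

Lemma lin0 (f : V -> W) : linear f -> f 0 = 0.
Proof. by move=> hf; have := hf (-1) 0 0; rewrite scaler0 addr0 scaleN1r addNr. Qed.
Lemma linZ (f : V -> W) c x : linear f -> f (c *: x) = c *: f x.
Proof. by move=> hf; have := hf c x 0; rewrite (lin0 hf) !addr0. Qed.
Lemma linD (f : V -> W) x y : linear f -> f (x + y) = f x + f y.
Proof. by move=> hf; have := hf 1 x y; rewrite !scale1r. Qed.
Lemma lin_sum (f : V -> W) (I : Type) (r : seq I) (g : I -> V) : linear f ->
  f (\sum_(i <- r) g i) = \sum_(i <- r) f (g i).
Proof.
by move=> hf; apply: (big_morph f) => [x y|]; [exact: linD | exact: lin0].
Qed.

Lemma sum_linear (I : Type) (r : seq I) (g : I -> V -> W) :
  (forall i, linear (g i)) -> linear (fun x => \sum_(i <- r) g i x).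
Proof.
move=> hg c x y; rewrite scaler_sumr -big_split /=.
by apply: eq_bigr => i _; rewrite hg.
Qed.

End LinearHelpers.

Section BilinearHelpers.
Variables (k : fieldType) (V W U T : lmodType k).

Lemma bilin_comp (V' W' : lmodType k) (b : V -> W -> U) (f : V' -> V)
    (g : W' -> W) : bilin b -> linear f -> linear g ->
  bilin (fun v w => b (f v) (g w)).
Proof.
move=> [hl hr] hf hg; split=> [w c v v'|v c w w'] /=; first by rewrite hf hl.
by rewrite hg hr.
Qed.

Lemma lin_bilin (b : V -> W -> U) (f : U -> T) :
  bilin b -> linear f -> bilin (fun v w => f (b v w)).
Proof.
by move=> [hl hr] hf; split=> [w c v v'|v c w w'] /=; rewrite (hl, hr) hf.
Qed.

Lemma tlift_param (b : T -> V -> W -> U) (t : tens V W) :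
  (forall v w, linear (fun x => b x v w)) -> linear (fun x => tlift (b x) t).
Proof.
move=> hb; rewrite /tlift /lext; apply: sum_linear => -[v w] c x y /=.
by rewrite hb scalerDr !scalerA mulrC.
Qed.

Lemma tlift_comp (b : V -> W -> U) (f : U -> T) (t : tens V W) :
  linear f -> f (tlift b t) = tlift (fun v w => f (b v w)) t.
Proof.
by move=> hf; rewrite /tlift /lext (lin_sum _ _ hf); apply: eq_bigr => p _; rewrite linZ.
Qed.

Lemma eq_tlift (b b' : V -> W -> U) (t : tens V W) :
  (forall v w, b v w = b' v w) -> tlift b t = tlift b' t.
Proof. by move=> h; apply: eq_bigr => p _; rewrite h. Qed.

End BilinearHelpers.

Lemma bilin_mul (k : fieldType) (A : algType k) : bilin (fun x y : A => x * y).
Proof.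
split=> [w c v v'|v c w w'] /=; first by rewrite mulrDl scalerAl.
by rewrite mulrDr scalerAr.
Qed.

Lemma linear_id (k : fieldType) (V : lmodType k) : linear (@id V).
Proof. by []. Qed.

Section TensorMaps.
Variable k : fieldType.

Definition tmap (V W V' W' : lmodType k) (f : V -> V') (g : W -> W')
  (t : tens V W) : tens V' W' := tlift (fun v w => f v \ox g w) t.

Definition tassoc (V W U : lmodType k) (t : tens (tens V W) U) :
    tens V (tens W U) :=
  tlift (fun vw u => tlift (fun v w => v \ox (w \ox u)) vw) t.

Definition tmul (A : algType k) (t u : tens A A) : tens A A :=
  tlift (fun a b => tlift (fun c d => (a * c) \ox (b * d)) u) t.

Lemma tmap_bilin (V W V' W' : lmodType k) (f : V -> V') (g : W -> W') :
  linear f -> linear g -> bilin (fun v w => f v \ox g w).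
Proof. by move=> hf hg; apply: bilin_comp hf hg; apply: tpure_bilin. Qed.

Lemma tassoc_bilin (V W U : lmodType k) (u : U) :
  bilin (fun (v : V) (w : W) => v \ox (w \ox u)).
Proof. exact: tmap_bilin (@linear_id _ _) (tpure_linl u). Qed.

Lemma tassoc_bilin2 (V W U : lmodType k) :
  bilin (fun (vw : tens V W) (u : U) => tlift (fun v w => v \ox (w \ox u)) vw).
Proof.
split=> [u|vw]; first exact: tlift_linear (tassoc_bilin _ _ u).
by apply: tlift_param => v w c u u'; rewrite !tpure_linr.
Qed.

Lemma tmap_linear (V W V' W' : lmodType k) (f : V -> V') (g : W -> W') :
  linear f -> linear g -> linear (tmap f g).
Proof. by move=> hf hg; apply: tlift_linear; apply: tmap_bilin. Qed.

Lemma tmap_pure (V W V' W' : lmodType k) (f : V -> V') (g : W -> W') v w :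
  linear f -> linear g -> tmap f g (v \ox w) = f v \ox g w.
Proof. by move=> hf hg; rewrite [LHS]tlift_pure //; apply: tmap_bilin. Qed.

Lemma tassoc_linear (V W U : lmodType k) : linear (@tassoc V W U).
Proof. by apply: tlift_linear; apply: tassoc_bilin2. Qed.

Lemma tassoc_pure (V W U : lmodType k) (v : V) (w : W) (u : U) :
  tassoc ((v \ox w) \ox u) = v \ox (w \ox u).
Proof.
rewrite [LHS]tlift_pure ?tlift_pure //; first exact: tassoc_bilin.
exact: tassoc_bilin2.
Qed.

Variable A : algType k.
Implicit Types t u : tens A A.

Lemma tmul_bilin1 (a b : A) :
  bilin (fun c d : A => (a * c) \ox (b * d)).
Proof.
by apply: tmap_bilin => c x y; apply: (bilin_mul A).2.
Qed.

Lemma tmul_bilin2 u :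
  bilin (fun a b : A => tlift (fun c d => (a * c) \ox (b * d)) u).
Proof.
split=> [b|a]; apply: tlift_param => x y c v v' /=.
  by rewrite (bilin_mul A).1 tpure_linl.
by rewrite (bilin_mul A).1 tpure_linr.
Qed.

Lemma tmul_pure (a b c d : A) : tmul (a \ox b) (c \ox d) = (a * c) \ox (b * d).
Proof. by rewrite /tmul (tlift_pure (tmul_bilin2 _)) (tlift_pure (tmul_bilin1 _ _)). Qed.

Lemma tmul_linl u : linear (fun t => tmul t u).
Proof. exact: tlift_linear (tmul_bilin2 u). Qed.

Lemma tmul_linr t : linear (tmul t).
Proof. apply: tlift_param => a b; exact: tlift_linear (tmul_bilin1 a b). Qed.

End TensorMaps.

Lemma tmap_tmul (k : fieldType) (A A' : algType k) (f : A -> A') (t u : tens A A) :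
  linear f -> {morph f : x y / x * y} ->
  tmul (tmap f f t) (tmap f f u) = tmap f f (tmul t u).
Proof.
move=> hf fM; have hm := tmap_linear hf hf.
move: t; apply: tlift_eq => [c x y|c x y|a b].
- by rewrite hm tmul_linl.
- by rewrite tmul_linl hm.
move: u; apply: tlift_eq => [c x y|c x y|a' b'].
- by rewrite hm tmul_linr.
- by rewrite tmul_linr hm.
by rewrite !(tmap_pure _ _ hf hf) !tmul_pure (tmap_pure _ _ hf hf) !fM.
Qed.

HB.mixin Record Lmodule_isCoalgebra (k : fieldType) C of GRing.Lmodule k C := {
  comul : C -> tens C C;
  counit : C -> k^o;
  comul_linear : linear comul;
  counit_linear : linear counit;
  comulA : forall c, tassoc (tmap comul id (comul c)) = tmap id comul (comul c);
  counitl : forall c, tlift (fun a b => counit a *: b) (comul c) = c;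
  counitr : forall c, tlift (fun a b => counit b *: a) (comul c) = c
}.
#[short(type="coalgType")]
HB.structure Definition Coalgebra (k : fieldType) :=
  {C of GRing.Lmodule k C & Lmodule_isCoalgebra k C}.

HB.mixin Record Algebra_Coalgebra_isBialgebra (k : fieldType) B
    of GRing.Algebra k B & Coalgebra k B := {
  comul1 : comul (1 : B) = 1 \ox 1;
  comulM : forall x y : B, comul (x * y) = tmul (comul x) (comul y);
  counit1 : counit (1 : B) = 1;
  counitM : forall x y : B, counit (x * y) = counit x * counit y :> k
}.
#[short(type="bialgType")]
HB.structure Definition Bialgebra (k : fieldType) :=
  {B of GRing.Algebra k B & Coalgebra k B & Algebra_Coalgebra_isBialgebra k B}.

Definition group_like (k : fieldType) (C : coalgType k) : set C :=
  [set c | comul c = c \ox c /\ counit c = 1].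

Section ModuleAlgebra.
Variables (k : fieldType) (B : bialgType k) (A : algType k).

Record module_algebra (act : B -> A -> A) : Prop := ModuleAlgebra {
  act_bilin : bilin act;
  act1 : forall a, act 1 a = a;
  actM : forall b c a, act (b * c) a = act b (act c a);
  act_mul : forall b (s : seq (B * B)), comul b = \sum_(p <- s) p.1 \ox p.2 ->
    forall a a', act b (a * a') = \sum_(p <- s) act p.1 a * act p.2 a';
  act_one : forall b, act b 1 = counit b *: 1
}.

End ModuleAlgebra.

Section MonoidAlgebra.
Variables (k : fieldType) (S : monoidType).

(* The product of [{malg k[S]}] in the library requires [x * y = 1] to imply
   [x = y = 1] in [S], so only its module structure is used. *)
Definition monoid_alg : Type := {malg k[S]}.
HB.instance Definition _ := GRing.Lmodule.on monoid_alg.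

Definition mdelta (s : S) : monoid_alg := << s >>.

Lemma monoid_alg_eq (U : lmodType k) (f g : monoid_alg -> U) :
  linear f -> linear g -> (forall s, f (mdelta s) = g (mdelta s)) -> f =1 g.
Proof.
move=> hf hg h x; have -> : x = \sum_(s <- msupp (x : {malg k[S]})) (x : {malg k[S]})@_s *: mdelta s.
  rewrite [LHS](monalgE x); apply: eq_bigr => s _.
  by apply/malgP => t; rewrite mcoeffZ !mcoeffU mulr_natr.
by rewrite (lin_sum _ _ hf) (lin_sum _ _ hg); apply: eq_bigr => s _; rewrite !linZ ?h.
Qed.

Definition mmul (x y : monoid_alg) : monoid_alg :=
  lext (fun s => lext (fun t => mdelta (s * t)%g) y) x.

Lemma mmul_linl y : linear (mmul^~ y).
Proof. by move=> c x x'; rewrite /mmul linearP. Qed.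
Lemma mmul_linr x : linear (mmul x).
Proof.
rewrite /mmul /lext; apply: sum_linear => s c y y'.
by rewrite -!/(lext _ _) linearP scalerDr !scalerA mulrC.
Qed.
Lemma mmul_delta s t : mmul (mdelta s) (mdelta t) = mdelta (s * t)%g.
Proof. by rewrite /mmul !lextU. Qed.

Lemma mmulA : associative mmul.
Proof.
move=> x y z; move: x; apply: monoid_alg_eq => [|c x x'|s].
- exact: mmul_linl.
- by rewrite !mmul_linl.
move: y; apply: monoid_alg_eq => [c y y'|c y y'|t].
- by rewrite mmul_linl mmul_linr.
- by rewrite mmul_linr mmul_linl.
move: z; apply: monoid_alg_eq => [c z z'|c z z'|u].
- by rewrite !mmul_linr.
- by rewrite mmul_linr.
by rewrite !mmul_delta mulgA.
Qed.
Lemma mmul1l : left_id (mdelta 1%g) mmul.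
Proof.
apply: monoid_alg_eq => [||s]; [exact: mmul_linr | exact: linear_id|].
by rewrite mmul_delta mul1g.
Qed.
Lemma mmul1r : right_id (mdelta 1%g) mmul.
Proof.
apply: monoid_alg_eq => [||s]; [exact: mmul_linl | exact: linear_id|].
by rewrite mmul_delta mulg1.
Qed.
Lemma mmulDl : left_distributive mmul +%R.
Proof. by move=> x y z; rewrite (linD _ _ (mmul_linl z)). Qed.
Lemma mmulDr : right_distributive mmul +%R.
Proof. by move=> x y z; rewrite (linD _ _ (mmul_linr x)). Qed.
Lemma mone_neq0 : mdelta 1%g != 0.
Proof.
apply/eqP => /(congr1 (fun x : {malg k[S]} => x@_1%g)) /eqP.
by rewrite mcoeffUU mcoeff0 oner_eq0.
Qed.

HB.instance Definition _ := GRing.Zmodule_isNzRing.Build monoid_alg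
  mmulA mmul1l mmul1r mmulDl mmulDr mone_neq0.
Lemma mmulZl (c : k) (x y : monoid_alg) : c *: (x * y) = (c *: x) * y.
Proof. by rewrite -(linZ _ _ (mmul_linl y)). Qed.
HB.instance Definition _ := GRing.Lmodule_isLalgebra.Build k monoid_alg mmulZl.
Lemma mmulZr (c : k) (x y : monoid_alg) : c *: (x * y) = x * (c *: y).
Proof. by rewrite -(linZ _ _ (mmul_linr x)). Qed.
HB.instance Definition _ := GRing.Lalgebra_isAlgebra.Build k monoid_alg mmulZr.

Lemma mdelta1 : mdelta 1%g = 1. Proof. by []. Qed.
Lemma mdeltaM s t : mdelta (s * t)%g = mdelta s * mdelta t.
Proof. by rewrite -mmul_delta. Qed.

Definition mcomul : monoid_alg -> tens monoid_alg monoid_alg :=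
  lext (fun s => mdelta s \ox mdelta s).
Definition mcounit : monoid_alg -> k^o := lext (fun _ => 1).

Lemma mcomul_linear : linear mcomul. Proof. by move=> c x y; rewrite /mcomul linearP. Qed.
Lemma mcounit_linear : linear mcounit. Proof. by move=> c x y; rewrite /mcounit linearP. Qed.
Lemma mcomul_delta s : mcomul (mdelta s) = mdelta s \ox mdelta s.
Proof. by rewrite /mcomul lextU. Qed.
Lemma mcounit_delta s : mcounit (mdelta s) = 1.
Proof. by rewrite /mcounit lextU. Qed.

Lemma mcomulA c : tassoc (tmap mcomul id (mcomul c)) = tmap id mcomul (mcomul c).
Proof.
have hi := @linear_id k monoid_alg.
move: c; apply: monoid_alg_eq => [c x y|c x y|s].
- rewrite mcomul_linear (tmap_linear mcomul_linear hi).
  exact: (@tassoc_linear k monoid_alg monoid_alg monoid_alg).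
- by rewrite mcomul_linear (tmap_linear hi mcomul_linear).
rewrite mcomul_delta (tmap_pure _ _ mcomul_linear hi).
by rewrite (tmap_pure _ _ hi mcomul_linear) mcomul_delta tassoc_pure.
Qed.

Lemma counit_bilin (C : lmodType k) (e : C -> k^o) : linear e ->
  bilin (fun a b : C => e a *: b) /\ bilin (fun a b : C => e b *: a).
Proof.
move=> he; split; split=> [w c v v'|v c w w'] /=;
  by rewrite ?he ?scalerDl ?scalerDr ?scalerA //= mulrC.
Qed.

Lemma mcounitl c : tlift (fun a b => mcounit a *: b) (mcomul c) = c.
Proof.
have hb := (counit_bilin mcounit_linear).1.
move: c; apply: monoid_alg_eq => [c x y||s]; last first.
- by rewrite mcomul_delta (tlift_pure hb) mcounit_delta scale1r.
- exact: linear_id.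
by rewrite mcomul_linear (tlift_linear hb).
Qed.
Lemma mcounitr c : tlift (fun a b => mcounit b *: a) (mcomul c) = c.
Proof.
have hb := (counit_bilin mcounit_linear).2.
move: c; apply: monoid_alg_eq => [c x y||s]; last first.
- by rewrite mcomul_delta (tlift_pure hb) mcounit_delta scale1r.
- exact: linear_id.
by rewrite mcomul_linear (tlift_linear hb).
Qed.

HB.instance Definition _ := Lmodule_isCoalgebra.Build k monoid_alg
  mcomul_linear mcounit_linear mcomulA mcounitl mcounitr.

Lemma mcomul1 : mcomul 1 = 1 \ox 1. Proof. exact: mcomul_delta. Qed.
Lemma mcounit1 : mcounit 1 = 1. Proof. exact: mcounit_delta. Qed.
Lemma mcomulM x y : mcomul (x * y) = tmul (mcomul x) (mcomul y).
Proof.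
move: x; apply: monoid_alg_eq => [c x x'|c x x'|s].
- by rewrite (bilin_mul _).1 mcomul_linear.
- by rewrite mcomul_linear tmul_linl.
move: y; apply: monoid_alg_eq => [c x x'|c x x'|t].
- by rewrite (bilin_mul _).2 mcomul_linear.
- by rewrite mcomul_linear tmul_linr.
by rewrite -mdeltaM !mcomul_delta tmul_pure -mdeltaM.
Qed.
Lemma mcounitM x y : mcounit (x * y) = mcounit x * mcounit y :> k.
Proof.
have hr z : linear (fun x => mcounit x * mcounit z : k^o).
  by move=> c u v; rewrite mcounit_linear mulrDl /GRing.scale /= mulrA.
have hl z : linear (fun x => mcounit z * mcounit x : k^o).
  by move=> c u v; rewrite mcounit_linear mulrDr /GRing.scale /= mulrCA.
apply: (monoid_alg_eq (f := fun x => mcounit (x * y)) _ (hr y)) => [c u v|s].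
  by rewrite (bilin_mul _).1 mcounit_linear.
apply: (monoid_alg_eq (f := fun y => mcounit (_ * y)) _ (hl _)) => [c u v|t].
  by rewrite (bilin_mul _).2 mcounit_linear.
by rewrite -mdeltaM !mcounit_delta mulr1.
Qed.

HB.instance Definition _ := Algebra_Coalgebra_isBialgebra.Build k monoid_alg
  mcomul1 mcomulM mcounit1 mcounitM.

End MonoidAlgebra.

Section Dual.
Variables (k : fieldType) (H : lmodType k).

Definition linear_pred : {pred (H -> k^o)} := memp [set f | linear f].

Lemma linear_subspace : subspace [set f : H -> k^o | linear f].
Proof.
split=> [c x y|a f g hf hg c x y] /=; first by rewrite scaler0 addr0.
rewrite /= !fctE hf hg !scalerDr !scalerA addrACA; congr (_ + _ + (_ + _)).
by rewrite mulrC.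
Qed.
HB.instance Definition _ := GRing.isSubmodClosed.Build k (H -> k^o) linear_pred
  (subspace_closed linear_subspace).

Record dual := Dual { dual_fun :> H -> k^o; dual_funP : dual_fun \in linear_pred }.
HB.instance Definition _ := [isSub for dual_fun].
HB.instance Definition _ := [Choice of dual by <:].
HB.instance Definition _ := [SubChoice_isSubLmodule of dual by <:].

Lemma dual_linear (f : dual) : linear f.
Proof. by have /asboolP := dual_funP f. Qed.

Definition mkdual (f : H -> k^o) (hf : linear f) : dual := Dual (asboolT hf).

Lemma dualP (f g : dual) : f =1 g -> f = g.
Proof. by move=> fg; apply/val_inj/funext. Qed.
Lemma dual0E x : (0 : dual) x = 0. Proof. by []. Qed.
Lemma dualDE (f g : dual) x : (f + g) x = f x + g x. Proof. by []. Qed.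
Lemma dualZE c (f : dual) x : (c *: f) x = c * f x. Proof. by []. Qed.
Lemma dual_ev_linear x : linear (fun f : dual => f x).
Proof. by []. Qed.

End Dual.

Section FiniteDual.
Variables (k : fieldType) (H : algType k).

Definition ideal (I : set H) : Prop :=
  [/\ I 0, forall x y, I x -> I y -> I (x + y),
      forall a x, I x -> I (a * x) & forall a x, I x -> I (x * a)].

(* The classes of [vs] span [H / I]. *)
Definition finite_codim (I : set H) : Prop :=
  exists vs : seq H, forall h, exists2 u, span [set` vs] u & I (h - u).

Definition finite_dual : set (dual H) :=
  [set f | exists I : set H,
    [/\ ideal I, finite_codim I & forall x, I x -> f x = 0]].

Lemma ideal_subspace I : ideal I -> subspace I.
Proof.
move=> [I0 ID Il _]; split=> // c x y Ix Iy; apply: ID => //.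
by rewrite -[x]mul1r scalerAl; apply: Il.
Qed.

Lemma subspace_sub (I : set H) x y : subspace I -> I x -> I y -> I (x - y).
Proof. by move=> [I0 ID] Ix Iy; rewrite addrC -scaleN1r; apply: ID. Qed.

Lemma span_cons (v : H) vs u : span [set` v :: vs] u ->
  exists c, span [set` vs] (u - c *: v).
Proof.
elim=> [|c x y /= xv _ [d hd]].
  by exists 0; rewrite scale0r subrr; apply: span0.
move: xv; rewrite inE => /orP[/eqP ->|xv]; [exists (c + d) | exists d].
  by rewrite scalerDl opprD addrACA subrr add0r.
by rewrite -addrA; apply: spanS.
Qed.

Lemma coord (I : set H) (vs : seq H) : subspace I ->
  (forall h, exists2 u, span [set` vs] u & I (h - u)) ->
  exists s : seq (dual H * H),
    (forall p x, p \in s -> I x -> p.1 x = 0) /\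
    forall h, I (h - \sum_(p <- s) p.1 h *: p.2).
Proof.
elim: vs I => [|v vs IH] I hI hvs.
  exists [::]; split=> // h; rewrite big_nil subr0.
  have [u hu] := hvs h; have -> : u = 0.
    by elim: hu => // c x y; rewrite /= in_nil.
  by rewrite subr0.
have [I0 ID] := hI.
pose I' : set H := fun x => exists c, I (x - c *: v).
have hI' : subspace I'.
  split=> [|c x y [a ha] [b hb]]; first by exists 0; rewrite scale0r subr0.
  exists (c * a + b); have := ID c _ _ ha hb; congr I.
  by rewrite scalerBr scalerA scalerDl opprD addrACA.
have [|s [sI' sE]] := IH I' hI'.
  move=> h; have [u hu Iu] := hvs h; have [c hc] := span_cons hu.
  by exists (u - c *: v) => //; exists c; rewrite opprB addrA addrAC addrK.
have [Iv|Iv] := pselect (I v).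
  have II' x : I' x -> I x.
    by move=> [c hc]; rewrite -[x](subrK (c *: v)) addrC; apply: ID.
  exists s; split=> [p x ps Ix|h]; last exact/II'.
  by apply: (sI' p) => //; exists 0; rewrite scale0r subr0.
have cuniq x a b : I (x - a *: v) -> I (x - b *: v) -> a = b.
  move=> ha hb; apply/eqP; rewrite -subr_eq0; apply: contrapT => /negP ab.
  apply: Iv; have := subspace_sub hI hb ha.
  rewrite opprB addrC addrA subrK -scalerBl => h.
  have := ID (a - b)^-1 _ _ h I0.
  by rewrite addr0 scalerA mulVf // scale1r.
pose pr h := h - \sum_(p <- s) p.1 h *: p.2.
have pr_lin : linear pr.
  move=> c x y; rewrite /pr scalerBr addrACA -opprD; congr (_ - _).
  rewrite scaler_sumr -big_split /=; apply: eq_bigr => p _.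
  by rewrite dual_linear scalerDl scalerA.
pose e h : k^o := projT1 (cid (sE h)).
have eP h : I (pr h - e h *: v) by rewrite /e; case: cid.
have e_lin : linear e.
  move=> c x y; apply: (cuniq (pr (c *: x + y))) => //.
  have := ID c _ _ (eP x) (eP y); congr I.
  by rewrite pr_lin scalerDl scalerBr scalerA opprD addrACA.
have prI x : I x -> pr x = x.
  move=> Ix; rewrite /pr big_seq big1 ?subr0 // => p ps.
  by rewrite (sI' p) ?scale0r //; exists 0; rewrite scale0r subr0.
exists ((mkdual e_lin, v) :: s); split=> [p x|h].
  rewrite inE => /orP[/eqP -> Ix|ps Ix] /=.
    by apply: (cuniq x); rewrite ?scale0r ?subr0 // -{1}(prI x Ix).
  by apply: (sI' p) => //; exists 0; rewrite scale0r subr0.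
by rewrite big_cons opprD addrA addrAC; apply: eP.
Qed.

Lemma dual_mull_linear (f : dual H) a : linear (fun x => f (a * x)).
Proof. by move=> c x y; rewrite (bilin_mul H).2 dual_linear. Qed.
Lemma dual_mulr_linear (f : dual H) a : linear (fun x => f (x * a)).
Proof. by move=> c x y; rewrite (bilin_mul H).1 dual_linear. Qed.

Lemma finite_dual_split2 (f : dual H) : finite_dual f ->
  exists s : seq (dual H * dual H),
    (forall p, p \in s -> finite_dual p.1 /\ finite_dual p.2) /\
    forall x y, f (x * y) = \sum_(p <- s) p.1 x * p.2 y.
Proof.
move=> [I [hI [vs hvs] fI]]; have hs := ideal_subspace hI.
have [s [sI sE]] := coord hs hvs; have [_ _ Il Ir] := hI.
exists [seq (p.1, mkdual (dual_mull_linear f p.2)) | p <- s]; split.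
  move=> _ /mapP[p ps ->] /=; split; exists I; split=> //; try by exists vs.
    by move=> x; apply: sI.
  by move=> x Ix /=; apply: fI; apply: Il.
move=> x y; rewrite big_map /=.
have /fI : I ((x - \sum_(p <- s) p.1 x *: p.2) * y) by exact: Ir.
rewrite (linD _ _ (dual_mulr_linear f y)) -scaleN1r.
rewrite (linZ _ _ (dual_mulr_linear f y)) scaleN1r => /subr0_eq ->.
rewrite mulr_suml (lin_sum _ _ (dual_linear f)); apply: eq_bigr => p _.
by rewrite -scalerAl (linZ _ _ (dual_linear f)).
Qed.

Lemma finite_dual_split3 (f : dual H) : finite_dual f ->
  exists s : seq (dual H * dual H * dual H), forall x y z,
    f (x * y * z) = \sum_(p <- s) p.1.1 x * p.1.2 y * p.2 z.
Proof.
move=> /finite_dual_split2[s [hs sE]].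
suff [t ht] : exists t : seq (dual H * dual H * dual H), forall x y z,
    \sum_(p <- s) p.1 x * p.2 (y * z) =
    \sum_(p <- t) p.1.1 x * p.1.2 y * p.2 z.
  by exists t => x y z; rewrite -mulrA sE ht.
elim: s hs {sE} => [|[p q] s IH] hs.
  by exists [::] => x y z; rewrite !big_nil.
have [|t ht] := IH; first by move=> r rs; apply: hs; rewrite inE rs orbT.
have [_ /finite_dual_split2[u [_ uE]]] := hs _ (mem_head _ _).
exists ([seq (p, r.1, r.2) | r <- u] ++ t) => x y z.
rewrite big_cons big_cat big_map /= ht uE mulr_sumr; congr (_ + _).
by apply: eq_bigr => r _; rewrite mulrA.
Qed.

Lemma kernel_codim (s : seq (dual H)) :
  finite_codim [set x | forall f, f \in s -> f x = 0].
Proof.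
elim: s => [|f s [vs hvs]].
  by exists [::] => h; exists 0 => //; apply: span0.
have vsS (v : H) u : span [set` vs] u -> span [set` v :: vs] u.
  elim=> [|c x y xv _ ih]; first exact: span0.
  by apply: spanS => //; rewrite /= inE xv orbT.
have [[w [ws /eqP fw]]|/forallNP wN] := pselect
  (exists w, (forall g, g \in s -> g w = 0) /\ f w <> 0); last first.
  exists vs => h; have [u hu su] := hvs h; exists u => // g.
  rewrite inE => /orP[/eqP -> |]; last exact: su.
  by apply: contrapT => fN; apply: (wN (h - u)).
exists (w :: vs) => h; have [u hu su] := hvs h.
exists (f (h - u) / f w *: w + u).
  by apply: spanS; [rewrite /= inE eqxx | exact: vsS].
set d := f (h - u) / f w => g gs.
have -> : h - (d *: w + u) = - d *: w + (h - u).
  by rewrite opprD addrCA scaleNr.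
rewrite dual_linear; move: gs; rewrite inE => /orP[/eqP ->|gs].
  by rewrite /GRing.scale /= mulNr /d divfK // addNr.
by rewrite ws // (su _ gs) scaler0 addr0.
Qed.

Lemma finite_dual_split3V (f : dual H) (s : seq (dual H * dual H * dual H)) :
  (forall x y z, f (x * y * z) = \sum_(p <- s) p.1.1 x * p.1.2 y * p.2 z) ->
  finite_dual f.
Proof.
move=> hf; exists (fun x : H => forall a b : H, f (a * x * b) = 0); split.
- split=> [a b|x y hx hy a b|c x hx a b|c x hx a b].
  + by rewrite mulr0 mul0r (lin0 (dual_linear f)).
  + by rewrite mulrDr mulrDl (linD _ _ (dual_linear f)) hx hy addr0.
  + by rewrite mulrA hx.
  + by rewrite -!mulrA mulrA hx.
- have [vs hvs] := kernel_codim [seq p.1.2 | p <- s].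
  exists vs => h; have [u hu su] := hvs h; exists u => // a b.
  rewrite hf big_seq big1 // => p ps.
  by rewrite (su p.1.2 _) ?mulr0 ?mul0r //; apply/mapP; exists p.
by move=> x /(_ 1 1); rewrite mul1r mulr1.
Qed.

Lemma finite_dual_subspace : subspace finite_dual.
Proof.
split=> [|c f g /finite_dual_split3[s hs] /finite_dual_split3[t ht]].
  by apply: (@finite_dual_split3V _ [::]) => x y z; rewrite big_nil.
apply: (@finite_dual_split3V _ ([seq (c *: p.1.1, p.1.2, p.2) | p <- s] ++ t)).
move=> x y z; rewrite dualDE dualZE hs ht big_cat big_map /= mulr_sumr.
by congr (_ + _); apply: eq_bigr => p _; rewrite !mulrA.
Qed.

Definition finite_dual_pred : {pred dual H} := memp finite_dual.
HB.instance Definition _ := GRing.isSubmodClosed.Build k (dual H)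
  finite_dual_pred (subspace_closed finite_dual_subspace).

Record fdual := FDual { fdual_val :> dual H; fdual_valP : fdual_val \in finite_dual_pred }.
HB.instance Definition _ := [isSub for fdual_val].
HB.instance Definition _ := [Choice of fdual by <:].
HB.instance Definition _ := [SubChoice_isSubLmodule of fdual by <:].

Lemma fdual_finite (f : fdual) : finite_dual f.
Proof. exact/asboolP/fdual_valP. Qed.
Definition mkfdual (f : dual H) (hf : finite_dual f) : fdual := FDual (asboolT hf).

End FiniteDual.

Section TensorInjectivity.
Variables (k : fieldType) (V W : lmodType k) (X Y : Type).
Variables (eV : V -> X -> k) (eW : W -> Y -> k).
Hypothesis eV_lin : forall x, linear (fun v => eV v x : k^o).
Hypothesis eW_lin : forall y, linear (fun w => eW w y : k^o).
Hypothesis eV_sep : forall v, (forall x, eV v x = 0) -> v = 0.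
Hypothesis eW_sep : forall w, (forall y, eW w y = 0) -> w = 0.

Lemma tev_inj t u : (forall p, tev eV eW t p = tev eV eW u p) -> t = u.
Proof.
move=> h; apply/eqP; rewrite -subr_eq0; apply/eqP.
apply: (tev_sep eV_lin eW_lin eV_sep eW_sep) => p.
have hl := tev_linear eV_lin eW_lin p.
by rewrite addrC -scaleN1r hl h /GRing.scale /= mulN1r addNr.
Qed.

Lemma tev_pure v w p : tev eV eW (v \ox w) p = eV v p.1 * eW w p.2.
Proof. by rewrite [LHS](tlift_pure (tev_bilin eV_lin eW_lin p)). Qed.

End TensorInjectivity.

(* A space of functionals on an algebra that is closed under the transpose of
   the product is a coalgebra. *)
Section EvalCoalgebra.
Variables (k : fieldType) (H : algType k) (C : lmodType k).
Variable ev : C -> dual H.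
Hypothesis ev_linear : linear ev.
Hypothesis ev_inj : injective ev.

Definition evp (c : C) (x : H) : k := ev c x.
Definition ev2 : tens C C -> H * H -> k := tev evp evp.

Lemma evp_lin x : linear (fun c => evp c x : k^o).
Proof. by move=> a c d; rewrite /evp ev_linear. Qed.
Lemma evp_sep c : (forall x, evp c x = 0) -> c = 0.
Proof.
by move=> h; apply: ev_inj; apply: dualP => x; rewrite (lin0 ev_linear) [LHS]h.
Qed.
Lemma ev2_lin p : linear (fun t => ev2 t p : k^o).
Proof. exact: tev_linear evp_lin evp_lin p. Qed.
Lemma ev2_sep t : (forall p, ev2 t p = 0) -> t = 0.
Proof. exact: (tev_sep evp_lin evp_lin evp_sep evp_sep). Qed.
Lemma ev2_inj t u : (forall p, ev2 t p = ev2 u p) -> t = u.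
Proof. exact: (tev_inj evp_lin evp_lin evp_sep evp_sep). Qed.
Lemma ev2_pure c d p : ev2 (c \ox d) p = ev c p.1 * ev d p.2.
Proof. exact: (tev_pure evp_lin evp_lin). Qed.
Lemma ev2_sum (s : seq (C * C)) p :
  ev2 (\sum_(q <- s) q.1 \ox q.2) p = \sum_(q <- s) ev q.1 p.1 * ev q.2 p.2.
Proof. exact: (tev_sum evp_lin evp_lin). Qed.

Hypothesis cop : forall c, exists t, forall x y, ev2 t (x, y) = ev c (x * y).

Definition ecomul (c : C) : tens C C := projT1 (cid (cop c)).
Definition ecounit (c : C) : k^o := ev c 1.

Lemma ecomulE c x y : ev2 (ecomul c) (x, y) = ev c (x * y).
Proof. by rewrite /ecomul; case: cid. Qed.

Lemma ecomul_linear : linear ecomul.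
Proof.
move=> a c d; apply: ev2_inj => -[x y].
by rewrite ev2_lin !ecomulE ev_linear.
Qed.

Lemma ecounit_linear : linear ecounit.
Proof. by move=> a c d; rewrite /ecounit ev_linear. Qed.

Lemma ecomulA c : tassoc (tmap ecomul id (ecomul c)) = tmap id ecomul (ecomul c).
Proof.
have hi := @linear_id k C.
apply: (tev_inj evp_lin ev2_lin evp_sep ev2_sep) => -[x [y z]].
have [s sE] := tensE (ecomul c).
have tevl := tev_linear evp_lin ev2_lin (x, (y, z)).
have tassocl := @tassoc_linear k C C C.
have lhs t d : tev evp ev2 (tassoc (t \ox d)) (x, (y, z)) = ev2 t (x, y) * ev d z.
  have hf : linear (fun t => tev evp ev2 (tassoc (t \ox d)) (x, (y, z)) : k^o).
    by move=> a u v; rewrite tpure_linl tassocl tevl.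
  have hg : linear (fun t => ev2 t (x, y) * ev d z : k^o).
    by move=> a u v; rewrite ev2_lin mulrDl /GRing.scale /= mulrA.
  apply: (tlift_eq hf hg) => a b.
  rewrite tassoc_pure (tev_pure evp_lin ev2_lin) /= !ev2_pure /=.
  by rewrite mulrA.
rewrite sE (lin_sum _ _ (tmap_linear ecomul_linear hi)) (lin_sum _ _ tassocl).
rewrite (lin_sum _ _ tevl) (lin_sum _ _ (tmap_linear hi ecomul_linear)).
rewrite (lin_sum _ _ tevl).
transitivity (ev2 (ecomul c) (x * y, z)).
  rewrite sE ev2_sum; apply: eq_bigr => p _.
  by rewrite (tmap_pure _ _ ecomul_linear hi) lhs ecomulE.
rewrite ecomulE -mulrA -ecomulE sE ev2_sum; apply: eq_bigr => p _.
by rewrite (tmap_pure _ _ hi ecomul_linear) (tev_pure evp_lin ev2_lin) /= ecomulE.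
Qed.

Lemma ecounitl c : tlift (fun a b => ecounit a *: b) (ecomul c) = c.
Proof.
have hb := (counit_bilin ecounit_linear).1; have [s sE] := tensE (ecomul c).
apply: ev_inj; apply: dualP => y; rewrite -[in RHS](mul1r y) -[RHS]ecomulE sE ev2_sum.
rewrite (tlift_sum hb) [LHS](lin_sum _ _ (evp_lin y)); apply: eq_bigr => p _.
by rewrite (tlift_pure hb) [LHS](linZ _ _ (evp_lin y)).
Qed.
Lemma ecounitr c : tlift (fun a b => ecounit b *: a) (ecomul c) = c.
Proof.
have hb := (counit_bilin ecounit_linear).2; have [s sE] := tensE (ecomul c).
apply: ev_inj; apply: dualP => y; rewrite -[in RHS](mulr1 y) -[RHS]ecomulE sE ev2_sum.
rewrite (tlift_sum hb) [LHS](lin_sum _ _ (evp_lin y)); apply: eq_bigr => p _.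
by rewrite (tlift_pure hb) [LHS](linZ _ _ (evp_lin y)) [RHS]mulrC.
Qed.

End EvalCoalgebra.

Section FiniteDualCoalgebra.
Variables (k : fieldType) (H : algType k).

Lemma fdual_val_linear : linear (@fdual_val k H). Proof. by []. Qed.
Lemma fdual_val_inj : injective (@fdual_val k H). Proof. exact: val_inj. Qed.

Lemma fdual_cop (f : fdual H) :
  exists t, forall x y, ev2 (@fdual_val k H) t (x, y) = f (x * y).
Proof.
have [s [hs sE]] := finite_dual_split2 (fdual_finite f).
suff [t ht] : exists t : tens (fdual H) (fdual H), forall x y,
    ev2 (@fdual_val k H) t (x, y) = \sum_(p <- s) p.1 x * p.2 y.
  by exists t => x y; rewrite ht sE.
elim: s hs {sE} => [|p s IH] hs.
  exists 0 => x y; rewrite big_nil.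
  exact: (lin0 (ev2_lin fdual_val_linear (x, y))).
have [|t ht] := IH; first by move=> q qs; apply: hs; rewrite inE qs orbT.
have [h1 h2] := hs _ (mem_head _ _).
exists (mkfdual h1 \ox mkfdual h2 + t) => x y.
rewrite (linD _ _ (ev2_lin fdual_val_linear (x, y))) big_cons.
by rewrite (ev2_pure fdual_val_linear) ht.
Qed.

Definition fcomul : fdual H -> tens (fdual H) (fdual H) := ecomul fdual_cop.
Definition fcounit : fdual H -> k^o := ecounit (@fdual_val k H).

Lemma fcomulE f x y : ev2 (@fdual_val k H) (fcomul f) (x, y) = f (x * y).
Proof. exact: ecomulE. Qed.

HB.instance Definition _ := Lmodule_isCoalgebra.Build k (fdual H)
  (ecomul_linear fdual_val_linear fdual_val_inj fdual_cop)
  (ecounit_linear fdual_val_linear)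
  (ecomulA fdual_val_linear fdual_val_inj fdual_cop)
  (ecounitl fdual_val_linear fdual_val_inj fdual_cop)
  (ecounitr fdual_val_linear fdual_val_inj fdual_cop).

End FiniteDualCoalgebra.

Section Convolution.
Variables (k : fieldType) (H : bialgType k).
Implicit Types f g h : dual H.

Definition cpair f g (t : tens H H) : k^o := tlift (fun a b => f a * g b : k^o) t.

Lemma cpair_bilin f g : bilin (fun a b : H => f a * g b : k^o).
Proof. exact: bilin_comp (bilin_mul (k^o)) (dual_linear f) (dual_linear g). Qed.
Lemma cpair_linear f g : linear (cpair f g).
Proof. exact: tlift_linear (cpair_bilin f g). Qed.
Lemma cpair_pure f g a b : cpair f g (a \ox b) = f a * g b.
Proof. exact: (tlift_pure (cpair_bilin f g)). Qed.

Lemma conv_linear f g : linear (fun x => cpair f g (comul x)).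
Proof. by move=> c x y; rewrite comul_linear cpair_linear. Qed.

Definition conv f g : dual H := mkdual (conv_linear f g).

Lemma convE f g x : conv f g x = cpair f g (comul x). Proof. by []. Qed.

Lemma conv_bilin : bilin conv.
Proof.
split=> [h c f g|h c f g]; apply: dualP => x; rewrite dualDE dualZE !convE.
  apply: (tlift_param (b := fun f a b => f a * h b : k^o)) => a b d u v.
  by rewrite dualDE dualZE mulrDl /GRing.scale /= mulrA.
apply: (tlift_param (b := fun f a b => h a * f b : k^o)) => a b d u v.
by rewrite dualDE dualZE mulrDr /GRing.scale /= mulrCA.
Qed.

Lemma mul3_linear (W : lmodType k) (phi : W -> k^o) (a b : k) :
  linear phi -> linear (fun t => a * phi t * b : k^o).
Proof.
move=> hp c x y; rewrite hp mulrDr mulrDl /GRing.scale /=; congr (_ + _).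
by rewrite !mulrA [a * c]mulrC.
Qed.

Lemma conv_split3 f g (s t : seq (dual H * dual H * dual H)) :
  (forall x y z, f (x * y * z) = \sum_(p <- s) p.1.1 x * p.1.2 y * p.2 z) ->
  (forall x y z, g (x * y * z) = \sum_(p <- t) p.1.1 x * p.1.2 y * p.2 z) ->
  forall x y z, conv f g (x * y * z) = \sum_(p <- s) \sum_(q <- t)
    conv p.1.1 q.1.1 x * conv p.1.2 q.1.2 y * conv p.2 q.2 z.
Proof.
move=> hf hg x y z; rewrite convE !comulM.
have lin_sum2 (W : lmodType k) (F : _ -> _ -> W -> k^o) :
    (forall p q, linear (F p q)) ->
    linear (fun w => \sum_(p <- s) \sum_(q <- t) F p q w).
  by move=> hF; apply: sum_linear => p; apply: sum_linear.
pose rhs X Y Z : k^o := \sum_(p <- s) \sum_(q <- t)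
  cpair p.1.1 q.1.1 X * cpair p.1.2 q.1.2 Y * cpair p.2 q.2 Z.
have rl1 Y Z : linear (rhs^~ Y ^~ Z).
  apply: lin_sum2 => p q c u v.
  rewrite -!mulrA -[cpair p.1.1 _ _]mul1r.
  by have := mul3_linear 1 (cpair p.1.2 q.1.2 Y * cpair p.2 q.2 Z)
    (cpair_linear p.1.1 q.1.1) c u v; rewrite !mul1r.
have rl2 X Z : linear (rhs X ^~ Z).
  by apply: lin_sum2 => p q; apply: mul3_linear; apply: cpair_linear.
have rl3 X Y : linear (rhs X Y).
  apply: lin_sum2 => p q c u v.
  by have := mul3_linear (cpair p.1.1 q.1.1 X * cpair p.1.2 q.1.2 Y) 1
    (cpair_linear p.2 q.2) c u v; rewrite !mulr1.
suff main X Y Z : cpair f g (tmul (tmul X Y) Z) = rhs X Y Z by exact: main.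
move: X; apply: tlift_eq => [c u v||a1 a2] //.
- by rewrite !tmul_linl cpair_linear.
move: Y; apply: tlift_eq => [c u v||b1 b2] //.
- by rewrite tmul_linr tmul_linl cpair_linear.
move: Z; apply: tlift_eq => [c u v||c1 c2] //.
- by rewrite tmul_linr cpair_linear.
rewrite !tmul_pure cpair_pure hf hg mulr_suml; apply: eq_bigr => p _.
rewrite mulr_sumr; apply: eq_bigr => q _.
by rewrite !cpair_pure mulrACA [X in X * _]mulrACA.
Qed.

Lemma conv_finite f g : finite_dual f -> finite_dual g -> finite_dual (conv f g).
Proof.
move=> /finite_dual_split3[s hs] /finite_dual_split3[t ht].
apply: (@finite_dual_split3V _ _ _ [seq (conv p.1.1 q.1.1, conv p.1.2 q.1.2,
  conv p.2 q.2) | p <- s, q <- t]) => x y z.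
by rewrite (conv_split3 hs ht) big_allpairs_dep.
Qed.

Definition dcounit : dual H := mkdual (@counit_linear k H).

Lemma dcounit_finite : finite_dual dcounit.
Proof.
apply: (@finite_dual_split3V _ _ _ [:: (dcounit, dcounit, dcounit)]) => x y z.
by rewrite big_seq1 /= !counitM.
Qed.

Lemma convA f g h : conv f (conv g h) = conv (conv f g) h.
Proof.
apply: dualP => x; rewrite !convE.
pose tau (t : tens H (tens H H)) : k^o :=
  tlift (fun a u => f a * cpair g h u : k^o) t.
have tau_bilin : bilin (fun a u => f a * cpair g h u : k^o).
  exact: bilin_comp (bilin_mul (k^o)) (dual_linear f) (cpair_linear g h).
have tau_lin : linear tau by exact: tlift_linear tau_bilin.
have hi := @linear_id k H; have hc := @comul_linear k H.
have tassocl := @tassoc_linear k H H H.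
have lhs t : cpair f (conv g h) t = tau (tmap id comul t).
  move: t; apply: tlift_eq => [|c u v|a b]; first exact: cpair_linear.
    by rewrite (tmap_linear hi hc) tau_lin.
  by rewrite cpair_pure (tmap_pure _ _ hi hc) [RHS](tlift_pure tau_bilin).
have rhs t : cpair (conv f g) h t = tau (tassoc (tmap comul id t)).
  move: t; apply: tlift_eq => [|c u v|a b]; first exact: cpair_linear.
    by rewrite (tmap_linear hc hi) tassocl tau_lin.
  rewrite cpair_pure (tmap_pure _ _ hc hi) convE.
  have hl : linear (fun t => cpair f g t * h b : k^o).
    move=> c u v; have := mul3_linear 1 (h b) (cpair_linear f g) c u v.
    by rewrite !mul1r.
  have hr : linear (fun t => tau (tassoc (t \ox b))).
    by move=> c u v; rewrite tpure_linl tassocl tau_lin.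
  apply: (tlift_eq hl hr) => c d.
  by rewrite tassoc_pure [RHS](tlift_pure tau_bilin) !cpair_pure mulrA.
by rewrite lhs rhs comulA.
Qed.

Lemma conv1l f : conv dcounit f = f.
Proof.
apply: dualP => x; rewrite convE -[in RHS](counitl x).
rewrite (tlift_comp _ _ (dual_linear f)); apply: eq_tlift => a b.
by rewrite (linZ _ _ (dual_linear f)).
Qed.
Lemma conv1r f : conv f dcounit = f.
Proof.
apply: dualP => x; rewrite convE -[in RHS](counitr x).
rewrite (tlift_comp _ _ (dual_linear f)); apply: eq_tlift => a b.
by rewrite (linZ _ _ (dual_linear f)) mulrC.
Qed.

End Convolution.

Section FiniteDualBialgebra.
Variables (k : fieldType) (H : bialgType k).
Implicit Types f g h : fdual H.

Definition fmul f g : fdual H :=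
  mkfdual (conv_finite (fdual_finite f) (fdual_finite g)).
Definition fone : fdual H := mkfdual (@dcounit_finite k H).

Lemma fmulA : associative fmul.
Proof. by move=> f g h; apply/fdual_val_inj/convA. Qed.
Lemma fmul1l : left_id fone fmul.
Proof. by move=> f; apply/fdual_val_inj/conv1l. Qed.
Lemma fmul1r : right_id fone fmul.
Proof. by move=> f; apply/fdual_val_inj/conv1r. Qed.
Lemma fmulDl : left_distributive fmul +%R.
Proof.
by move=> f g h; apply/fdual_val_inj; apply: (linD _ _ ((conv_bilin H).1 h)).
Qed.
Lemma fmulDr : right_distributive fmul +%R.
Proof.
by move=> f g h; apply/fdual_val_inj; apply: (linD _ _ ((conv_bilin H).2 f)).
Qed.
Lemma fone_neq0 : fone != 0.
Proof.
apply/eqP => /(congr1 (fun f : fdual H => f 1)) /=.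
by rewrite counit1 => /eqP; rewrite (oner_eq0 k).
Qed.

HB.instance Definition _ := GRing.Zmodule_isNzRing.Build (fdual H)
  fmulA fmul1l fmul1r fmulDl fmulDr fone_neq0.

Lemma fmulZl (c : k) f g : c *: (f * g) = (c *: f) * g.
Proof.
by apply/fdual_val_inj; rewrite [RHS](linZ _ _ ((conv_bilin H).1 g)).
Qed.
HB.instance Definition _ := GRing.Lmodule_isLalgebra.Build k (fdual H) fmulZl.
Lemma fmulZr (c : k) f g : c *: (f * g) = f * (c *: g).
Proof.
by apply/fdual_val_inj; rewrite [RHS](linZ _ _ ((conv_bilin H).2 f)).
Qed.
HB.instance Definition _ := GRing.Lalgebra_isAlgebra.Build k (fdual H) fmulZr.

Lemma fmulE f g : (f * g : fdual H) = conv f g :> dual H. Proof. by []. Qed.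

Let vl := @fdual_val_linear k H.
Let vi := @fdual_val_inj k H.

Lemma fcomul1 : comul (1 : fdual H) = 1 \ox 1.
Proof.
apply: (ev2_inj vl vi) => -[x y]; rewrite [LHS]fcomulE (ev2_pure vl).
exact: counitM.
Qed.

Lemma fcomulM f g : comul (f * g) = tmul (comul f) (comul g).
Proof.
apply: (ev2_inj vl vi) => -[x y]; rewrite [LHS]fcomulE fmulE convE comulM.
have [s sE] := tensE (comul f); have [t tE] := tensE (comul g).
have fE x' y' : f (x' * y') = \sum_(p <- s) p.1 x' * p.2 y'.
  by rewrite -fcomulE [fcomul f]sE (ev2_sum vl).
have gE x' y' : g (x' * y') = \sum_(p <- t) p.1 x' * p.2 y'.
  by rewrite -fcomulE [fcomul g]tE (ev2_sum vl).
transitivity (\sum_(p <- s) \sum_(q <- t)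
    cpair p.1 q.1 (comul x) * cpair p.2 q.2 (comul y) : k^o); last first.
  rewrite sE tE (lin_sum _ _ (tmul_linl _)) (lin_sum _ _ (ev2_lin vl (x, y))).
  apply: eq_bigr => p _.
  rewrite (lin_sum _ _ (tmul_linr _)) (lin_sum _ _ (ev2_lin vl (x, y))).
  by apply: eq_bigr => q _; rewrite tmul_pure (ev2_pure vl).
move: (comul x) (comul y) => X Y.
pose rhs (X Y : tens H H) : k^o :=
  \sum_(p <- s) \sum_(q <- t) cpair p.1 q.1 X * cpair p.2 q.2 Y.
have rl1 Z : linear (rhs^~ Z).
  apply: sum_linear => p; apply: sum_linear => q c u v.
  have := mul3_linear (k := k) 1 (cpair p.2 q.2 Z) (cpair_linear p.1 q.1) c u v.
  by rewrite !mul1r.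
have rl2 Z : linear (rhs Z).
  apply: sum_linear => p; apply: sum_linear => q c u v.
  have := mul3_linear (k := k) (cpair p.1 q.1 Z) 1 (cpair_linear p.2 q.2) c u v.
  by rewrite !mulr1.
suff main : cpair f g (tmul X Y) = rhs X Y by exact: main.
move: X; apply: tlift_eq => [c u v||a1 a2] //.
- by rewrite tmul_linl cpair_linear.
move: Y; apply: tlift_eq => [c u v||b1 b2] //.
- by rewrite tmul_linr cpair_linear.
rewrite tmul_pure cpair_pure fE gE mulr_suml; apply: eq_bigr => p _.
rewrite mulr_sumr; apply: eq_bigr => q _.
by rewrite !cpair_pure mulrACA.
Qed.

Lemma fcounit1 : counit (1 : fdual H) = 1.
Proof. exact: counit1. Qed.

Lemma fcounitM f g : counit (f * g) = counit f * counit g :> k.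
Proof. by rewrite /counit /= /fcounit /ecounit fmulE convE comul1 cpair_pure. Qed.

HB.instance Definition _ := Algebra_Coalgebra_isBialgebra.Build k (fdual H)
  fcomul1 fcomulM fcounit1 fcounitM.

End FiniteDualBialgebra.

Section GroupLikeSpan.
Variables (k : fieldType) (B : bialgType k).

Definition kG_pred : {pred B} := memp (span (@group_like k B)).

Lemma group_like1 : group_like (1 : B).
Proof. by split; [exact: comul1 | exact: counit1]. Qed.

Lemma group_likeM (x y : B) : group_like x -> group_like y -> group_like (x * y).
Proof.
move=> [dx ex] [dy ey]; split; first by rewrite comulM dx dy tmul_pure.
by rewrite counitM ex ey mulr1.
Qed.

Lemma kG_closed : GRing.subalg_closed kG_pred.
Proof.
have [_ hD] := subspace_closed (span_subspace (@group_like k B)).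
split=> //; first exact/asboolP/span_in/group_like1.
move=> x y /asboolP hx /asboolP hy; apply/asboolP.
elim: hx => [|c u v gu _ ih]; first by rewrite mul0r; apply: span0.
rewrite mulrDl -scalerAl; apply: (span_subspace _).2 ih.
elim: hy => [|d w z gw _ ih]; first by rewrite mulr0; apply: span0.
by rewrite mulrDr -scalerAr; apply: spanS => //; apply: group_likeM.
Qed.

HB.instance Definition _ := GRing.isSubalgClosed.Build k B kG_pred kG_closed.

Record kG := KG { kG_val :> B; kG_valP : kG_val \in kG_pred }.
HB.instance Definition _ := [isSub for kG_val].
HB.instance Definition _ := [Choice of kG by <:].
HB.instance Definition _ := [SubChoice_isSubAlgebra of kG by <:].

End GroupLikeSpan.

Section GroupLikeBialgebra.
Variables (k : fieldType) (H : bialgType k).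

Local Notation G := (kG (fdual H)).

Definition kG_dual (b : G) : dual H := fdual_val (kG_val b).

Lemma kG_dual_linear : linear kG_dual. Proof. by []. Qed.
Lemma kG_dual_inj : injective kG_dual.
Proof. by move=> b c /fdual_val_inj/val_inj. Qed.

Let vl := @fdual_val_linear k H.
Let vi := @fdual_val_inj k H.

Lemma group_like_fdualM (g : fdual H) x y : group_like g -> g (x * y) = g x * g y.
Proof. by move=> [dg _]; rewrite -fcomulE [fcomul g]dg (ev2_pure vl). Qed.

Lemma kG_cop (b : G) : exists t, forall x y, ev2 kG_dual t (x, y) = kG_dual b (x * y).
Proof.
have /asboolP hb := kG_valP b; rewrite /kG_dual.
elim: hb => [|c g u hg _ [t ht]].
  by exists 0 => x y; rewrite (lin0 (ev2_lin kG_dual_linear (x, y))).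
have gG : g \in @kG_pred k (fdual H) by exact/asboolP/span_in.
exists (c *: (KG gG \ox KG gG) + t) => x y.
rewrite (ev2_lin kG_dual_linear) (ev2_pure kG_dual_linear) ht /=.
by rewrite /kG_dual /= -group_like_fdualM.
Qed.

Definition kG_comul : G -> tens G G := ecomul kG_cop.
Definition kG_counit : G -> k^o := ecounit kG_dual.

HB.instance Definition _ := Lmodule_isCoalgebra.Build k G
  (ecomul_linear kG_dual_linear kG_dual_inj kG_cop)
  (ecounit_linear kG_dual_linear)
  (ecomulA kG_dual_linear kG_dual_inj kG_cop)
  (ecounitl kG_dual_linear kG_dual_inj kG_cop)
  (ecounitr kG_dual_linear kG_dual_inj kG_cop).

Let val_lin : linear (@kG_val k (fdual H)). Proof. by []. Qed.

Lemma ev2_val (t : tens G G) p :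
  ev2 (@fdual_val k H) (tmap (@kG_val _ _) (@kG_val _ _) t) p = ev2 kG_dual t p.
Proof.
move: t; apply: (@tlift_eq k G G k^o) => [c u v|c u v|a b].
- by rewrite (tmap_linear val_lin val_lin) (ev2_lin vl).
- exact: (ev2_lin kG_dual_linear).
by rewrite (tmap_pure _ _ val_lin val_lin) (ev2_pure vl) (ev2_pure kG_dual_linear).
Qed.

Lemma tmap_val_inj : injective (tmap (@kG_val _ _) (@kG_val _ _) : tens G G -> _).
Proof.
by move=> t u tu; apply: (ev2_inj kG_dual_linear kG_dual_inj) => p; rewrite -!ev2_val tu.
Qed.

Lemma kG_comulE (b : G) :
  tmap (@kG_val _ _) (@kG_val _ _) (comul b) = comul (kG_val b).
Proof.
apply: (ev2_inj vl vi) => -[x y]; rewrite ev2_val [RHS]fcomulE.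
exact: (ecomulE kG_cop).
Qed.

Lemma kG_counitE (b : G) : counit b = counit (kG_val b). Proof. by []. Qed.

Lemma kG_comul1 : comul (1 : G) = 1 \ox 1.
Proof.
apply: tmap_val_inj; rewrite kG_comulE (tmap_pure _ _ val_lin val_lin).
exact: comul1.
Qed.

Lemma kG_comulM (b c : G) : comul (b * c) = tmul (comul b) (comul c).
Proof.
apply: tmap_val_inj; rewrite kG_comulE [LHS]comulM -!kG_comulE.
by apply: tmap_tmul.
Qed.

Lemma kG_counit1 : counit (1 : G) = 1. Proof. exact: counit1. Qed.
Lemma kG_counitM (b c : G) : counit (b * c) = counit b * counit c :> k.
Proof. exact: (@counitM k (fdual H) (kG_val b) (kG_val c)). Qed.

HB.instance Definition _ := Algebra_Coalgebra_isBialgebra.Build k G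
  kG_comul1 kG_comulM kG_counit1 kG_counitM.

End GroupLikeBialgebra.

Lemma fmul_mdelta (k : fieldType) (S : monoidType)
  (f g : fdual (monoid_alg k S)) (s : S) :
  (f * g : fdual (monoid_alg k S)) (mdelta k s) = f (mdelta k s) * g (mdelta k s).
Proof. by rewrite fmulE convE [comul _]mcomul_delta cpair_pure. Qed.

Section Grading.
Variables (k : fieldType) (S : monoidType) (A : algType k).

Record grading := Grading {
  piece :> S -> set A;
  piece_subspace : forall s, subspace (piece s);
  piece_mul : forall s t a b, piece s a -> piece t b -> piece (s * t)%g (a * b);
  piece_direct : forall a, exists! c : {fsfun S -> A with 0},
    (forall s, piece s (c s)) /\ a = \sum_(s <- finsupp c) c s
}.

Variable gr : grading.

Definition component (a : A) : {fsfun S -> A with 0} :=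
  projT1 (cid (piece_direct gr a)).

Definition dual_act (f : dual (monoid_alg k S)) (a : A) : A :=
  \sum_(s <- finsupp (component a)) (f (mdelta k s) : k) *: (component a s : A).

Definition gamma (t : tens (dual (monoid_alg k S)) A) : A := tlift dual_act t.

Lemma component_piece a s : gr s (component a s).
Proof. by rewrite /component; case: cid => c /= [[]]. Qed.
Lemma componentE a : a = \sum_(s <- finsupp (component a)) component a s.
Proof. by rewrite /component; case: cid => c /= [[]]. Qed.
Lemma component_uniq a (c : {fsfun S -> A with 0}) :
  (forall s, gr s (c s)) -> a = \sum_(s <- finsupp c) c s -> component a = c.
Proof. by move=> h1 h2; rewrite /component; case: cid => d /= [_ hu]; apply: hu. Qed.

Lemma sum_finsuppw (F : S -> A -> A) (c : {fsfun S -> A with 0}) (d : {fset S}) :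
  (forall s, F s 0 = 0) -> (finsupp c `<=` d)%fset ->
  \sum_(s <- finsupp c) F s (c s) = \sum_(s <- d) F s (c s).
Proof.
by move=> F0 le; apply: big_fset_incl le _ => s _ /fsfun_dflt ->.
Qed.

Lemma component_linear a (x y : A) s :
  component (a *: x + y) s = a *: component x s + component y s.
Proof.
set d := (finsupp (component x) `|` finsupp (component y))%fset.
pose c : {fsfun S -> A with 0} :=
  [fsfun s in d => a *: component x s + component y s].
have cE t : c t = a *: component x t + component y t.
  rewrite fsfunE; case: ifP => // /negbT; rewrite in_fsetU negb_or => /andP[h1 h2].
  by rewrite !fsfun_dflt // scaler0 addr0.
rewrite (@component_uniq _ c) // => [t|]; first by rewrite cE; apply: (piece_subspace gr t).2; apply: component_piece.
have cd : (finsupp c `<=` d)%fset.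
  by apply/fsubsetP => t; rewrite mem_finsupp fsfunE; case: ifP => //; rewrite eqxx.
rewrite (sum_finsuppw (F := fun _ v => v) _ cd) //.
rewrite {1}(componentE x) {1}(componentE y).
rewrite (sum_finsuppw (F := fun _ v => v) (d := d)) ?fsubsetUl //.
rewrite (sum_finsuppw (F := fun _ v => v) (d := d)) ?fsubsetUr //.
by rewrite scaler_sumr -big_split /=; apply: eq_bigr => t _; rewrite cE.
Qed.

Lemma dual_act_bilin : bilin dual_act.
Proof.
rewrite /dual_act; split=> [a c f g|f c x y].
  rewrite scaler_sumr -big_split /=; apply: eq_bigr => s _.
  by rewrite [X in X *: _]/= scalerDl scalerA.
set d := (finsupp (component (c *: x + y)) `|` (finsupp (component x) `|` finsupp (component y)))%fset.
have F0 s : (f (mdelta k s) : k) *: (0 : A) = 0 by rewrite scaler0.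
rewrite !(sum_finsuppw (F := fun s v => (f (mdelta k s) : k) *: v) (d := d)) //.
- rewrite scaler_sumr -big_split /=; apply: eq_bigr => s _.
  by rewrite component_linear scalerDr !scalerA mulrC.
- by rewrite /d fsetUA fsubsetUr.
- by rewrite /d fsetUCA fsubsetUl.
- by rewrite /d fsubsetUl.
Qed.

Lemma gammaE (f : dual (monoid_alg k S)) a : gamma (f \ox a) = dual_act f a.
Proof. exact: (tlift_pure dual_act_bilin). Qed.

End Grading.

(* Main.v *)
Require Import Defs.
From mathcomp Require Import all_boot all_order all_algebra.
From mathcomp Require Import finmap.

Import GRing.Theory.
Local Open Scope ring_scope.

(** A functional [f] acts on the homogeneous piece of degree [s] as the scalar
    [f s] ([dual_act_homogeneous]), and linear maps on [A] are determined by
    their restriction to the pieces ([homogeneous_ext]).  Each module-algebra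
    axiom thereby reduces to a scalar identity in [k]:
    - the unit acts as the identity because it is the counit, of value 1 on [S];
    - the product of functionals acts by composition because it is pointwise
      on [S];
    - on [a] of degree [s] and [a'] of degree [t], the product [a * a'] has
      degree [s * t], and [f (s * t)] is the evaluation of the coproduct of [f]
      at [(s, t)]; so the last identity is the defining property of the
      coproduct on functionals;
    - [1] has degree [1], and [f 1] is the counit of [f]. *)

Section DualAction.
Local Set Implicit Arguments.
Local Unset Strict Implicit.
Variables (k : fieldType) (S : monoidType) (A : algType k) (gr : grading S A).
Implicit Types (f g : dual (monoid_alg k S)) (s t : S) (a : A).

(** The decomposition of [a] supported at the single degree [s] is a valid one,
    so by uniqueness it is the family of components of [a]. *)
Lemma dual_act_homogeneous f s a :
  gr s a -> dual_act gr f a = (f (mdelta k s) : k) *: a.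
Proof.
move=> ga; pose c : {fsfun S -> A with 0} := [fsfun t in [fset s]%fset => a].
have cs : c s = a by rewrite fsfunE inE eqxx.
have sub : (finsupp c `<=` [fset s])%fset.
  by apply/fsubsetP => t; rewrite mem_finsupp fsfunE; case: ifP; rewrite ?eqxx.
have cE : component gr a = c.
  apply: component_uniq => [t|].
    rewrite fsfunE inE; case: eqP => [->//|_].
    exact: (piece_subspace gr t).1.
  by rewrite (sum_finsuppw (F := fun _ v => v) _ sub) // big_seq_fset1 cs.
rewrite /dual_act cE (sum_finsuppw (F := fun t v => (f (mdelta k t) : k) *: v) _ sub).
  by rewrite big_seq_fset1 cs.
by move=> t; rewrite scaler0.
Qed.

Lemma homogeneous_ext (U : lmodType k) (F G : A -> U) :
  linear F -> linear G -> (forall s a, gr s a -> F a = G a) -> F =1 G.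
Proof.
move=> lF lG FG a; rewrite (componentE gr a) (lin_sum _ _ lF) (lin_sum _ _ lG).
by apply: eq_bigr => s _; apply: FG (component_piece gr a s).
Qed.

Lemma dual_act_linear f : linear (dual_act gr f).
Proof. exact: (dual_act_bilin gr).2. Qed.

Lemma dual_act_id f :
  (forall s, f (mdelta k s) = 1) -> dual_act gr f =1 id.
Proof.
move=> f1; apply: homogeneous_ext (dual_act_linear f) (@linear_id _ _) _ => s a ga.
by rewrite (dual_act_homogeneous _ ga) f1 scale1r.
Qed.

Lemma dual_act_comp (f g h : dual (monoid_alg k S)) :
  (forall s, h (mdelta k s) = f (mdelta k s) * g (mdelta k s)) ->
  dual_act gr h =1 dual_act gr f \o dual_act gr g.
Proof.
move=> hE; apply: homogeneous_ext (dual_act_linear h) _ _ => [c x y|s a ga] /=.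
  by rewrite !dual_act_linear.
rewrite !(dual_act_homogeneous _ ga) (linZ _ _ (dual_act_linear f)).
by rewrite (dual_act_homogeneous _ ga) hE scalerA mulrC.
Qed.

(** On [a] of degree [s] and [a'] of degree [t], the product [a * a'] has degree
    [s * t], so both sides are multiples of [a * a'], by the two scalars that the
    hypothesis equates; bilinearity in [a] and [a'] does the rest. *)
Lemma dual_act_mul f (I : Type) (r : seq I) (p q : I -> dual (monoid_alg k S)) :
  (forall s t, f (mdelta k s * mdelta k t) =
     \sum_(i <- r) p i (mdelta k s) * q i (mdelta k t)) ->
  forall a a', dual_act gr f (a * a') =
    \sum_(i <- r) dual_act gr (p i) a * dual_act gr (q i) a'.
Proof.
move=> fE a a'; move: a.
apply: homogeneous_ext => [c x y|c x y|s a ga].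
- by rewrite (bilin_mul A).1 dual_act_linear.
- move: c x y; apply: sum_linear => i c x y.
  by rewrite dual_act_linear (bilin_mul A).1.
move: a'; apply: homogeneous_ext => [c x y|c x y|t a' ga'].
- by rewrite (bilin_mul A).2 dual_act_linear.
- move: c x y; apply: sum_linear => i c x y.
  by rewrite dual_act_linear (bilin_mul A).2.
rewrite (dual_act_homogeneous _ (piece_mul ga ga')) mdeltaM fE scaler_suml.
apply: eq_bigr => i _.
rewrite (dual_act_homogeneous _ ga) (dual_act_homogeneous _ ga').
by rewrite -scalerAl -scalerAr scalerA.
Qed.

End DualAction.

(** Evaluation of tensors at pairs turns any expression of the coproduct as a
    sum of pure tensors into an expansion of [b (x * y)]. *)
Lemma kG_comul_eval {k : fieldType} {H : bialgType k} {b : kG (fdual H)}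
    {r : seq (kG (fdual H) * kG (fdual H))} :
  comul b = \sum_(p <- r) p.1 \ox p.2 ->
  forall x y, kG_dual b (x * y) = \sum_(p <- r) kG_dual p.1 x * kG_dual p.2 y.
Proof.
move=> bE x y; rewrite -(ecomulE (@kG_cop k H)) -/(kG_comul b).
by rewrite [kG_comul b]bE (ev2_sum (@kG_dual_linear k H)).
Qed.

Theorem theorem2p14 (k : fieldType) (k_char0 : [pchar k] =i pred0)
    (S : monoidType) (A : algType k) (gr : grading S A)
    (unit_degree : gr 1%g 1) :
  module_algebra
    (fun (b : kG (fdual (monoid_alg k S))) (a : A) => gamma gr (kG_dual b \ox a)).
Proof.
split=> [|a|b c a|b r bE a a'|b].
- apply: lin_bilin (tlift_linear (dual_act_bilin gr)).
  exact: bilin_comp (tpure_bilin _ _) (@kG_dual_linear _ _) (@linear_id _ _).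
- by rewrite [LHS]gammaE; apply: dual_act_id => s; apply: mcounit_delta.
- rewrite [LHS]gammaE [RHS]gammaE [gamma gr (kG_dual c \ox a)]gammaE.
  by apply: dual_act_comp => s; apply: fmul_mdelta.
- rewrite [LHS]gammaE.
  rewrite (dual_act_mul gr (fun s t => kG_comul_eval bE (mdelta k s) (mdelta k t))).
  by apply: eq_bigr => p _; rewrite -!gammaE.
by rewrite [LHS]gammaE (dual_act_homogeneous _ unit_degree).
Qed.
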